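(* Let $A\in\mathbb{R}^{m\times m}$ be a constant symmetric matrix, $a<b<c<d$, and let $\mathbf U$ and $\mathbf V$ be the DGSEM approximations on $\Omega_u=[a,c]$ and $\Omega_v=[b,d]$ of the overset grid problem for the system $\boldsymbol\omega_t+A\boldsymbol\omega_x=0$ with characteristic boundary and interface conditions (upwind numerical flux), as defined in the context. For fixed polynomial order $N$, fixed mesh size and fixed time $T$, the energy is bounded by the initial data: there is a constant $K$, depending on $N$, the mesh, $T$ and $A$ but not on the initial data, such that $$\|\mathbf U(T)\|^2_{\Omega_u,N}+\|\mathbf V(T)\|^2_{\Omega_v,N}\le K\left(\|\boldsymbol\omega_0\|^2_{\Omega_u,N}+\|\boldsymbol\omega_0\|^2_{\Omega_v,N}\right).$$
   Context: Notation: $|A|$ is the matrix absolute value of the symmetric matrix $A$ and $A^{\pm}=\frac12(A\pm|A|)$. The upwind numerical flux is $\mathbf F^*(\mathbf U^L,\mathbf U^R)=A^+\mathbf U^L+A^-\mathbf U^R$, and $\mathbf F=A\mathbf U$ is the flux. Meshes: $\Omega_u$ and $\Omega_v$ are each divided into finitely many consecutive elements of equal size $\Delta x$ (the size may differ between the two grids); each element is mapped affinely and increasingly from $\xi\in[-1,1]$. Discretization: on each element the solution is a vector of $m$ polynomials of degree $\le N$ ($N\ge1$) in $\xi$ with time dependent coefficients. Let $\xi_j,w_j$, $j=0,\dots,N$, be the Legendre-Gauss-Lobatto nodes (including $\pm1$) and weights on $[-1,1]$, and $\langle\mathbf f,\mathbf g\rangle_N=\sum_{j=0}^N\mathbf f(\xi_j)^T\mathbf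 g(\xi_j)w_j$. On each element of the base grid, for all vector polynomials $\boldsymbol\phi$ of degree $\le N$, $$\tfrac{\Delta x}{2}\langle\mathbf U_t,\boldsymbol\phi\rangle_N+\boldsymbol\phi^T\{\mathbf F^*-\mathbf F\}\big|_{-1}^{1}+\langle A\mathbf U_\xi,\boldsymbol\phi\rangle_N=0,$$ and $\mathbf V$ satisfies the same equation on each element of the overset grid. At interior element interfaces $\mathbf F^*$ uses the traces from the two neighbouring elements. The external states are: $\mathbf 0$ (left state) at $x=a$ for $\mathbf U$; $\mathbf V(c,t)$ (right state) at $x=c$ for $\mathbf U$; $\mathbf U(b,t)$ (left state) at $x=b$ for $\mathbf V$; $\mathbf 0$ (right state) at $x=d$ for $\mathbf V$. Here $\mathbf V(c,t)$ and $\mathbf U(b,t)$ are values of the polynomial in the overset, respectively base, element containing the point. Norms: $\|\mathbf U\|^2_{\Omega_u,N}=\sum_k\frac{\Delta x}{2}\langle\mathbf U,\mathbf U\rangle_N$, summed over base elements, and similarly $\|\cdot\|_{\Omega_v,N}$ over overset elements. The initial values $\mathbf U(\cdot,0),\mathbf V(\cdot,0)$ are the elementwise interpolants of $\boldsymbol\omega_0$ at the nodes, so $\|\boldsymbol\omega_0\|_{\Omega_u,N}=\|\mathbf U(0)\|_{\Omega_u,N}$ and $\|\boldsymbol\omega_0\|_{\Omega_v,N}=\|\mathbf V(0)\|_{\Omega_v,N}$. *)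

(* Defs.v *)
From HB Require Import structures.
From mathcomp Require Import all_boot all_order all_algebra.
From mathcomp Require Import all_classical all_reals all_analysis.
From mathcomp Require Import complex ring.

Set Implicit Arguments.
Unset Strict Implicit.
Unset Printing Implicit Defensive.

Import Order.TTheory GRing.Theory Num.Theory.
Import numFieldNormedType.Exports.

Local Open Scope classical_set_scope.
Local Open Scope ring_scope.

Section MatrixAbs.
Context {R : realType} {m : nat}.
Implicit Types A B : 'M[R]_m.

Definition is_mxabs A B : Prop :=
  exists (Q : 'M[R]_m) (l : 'rV[R]_m),
    [/\ Q *m Q^T = 1%:M, A = Q^T *m diag_mx l *m Q
      & B = Q^T *m diag_mx (map_mx Num.norm l) *m Q].

(* For symmetric [A] such a [B] exists ([mxabsP]) and is unique
   ([mxabs_unique]), so the default [0] is never reached. *)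
Definition mxabs A : 'M[R]_m := xget 0 [set B | is_mxabs A B].

Definition mxpos A : 'M[R]_m := 2^-1 *: (A + mxabs A).
Definition mxneg A : 'M[R]_m := 2^-1 *: (A - mxabs A).

Definition flux A (u : 'cV[R]_m) : 'cV[R]_m := A *m u.

Definition upwind A (uL uR : 'cV[R]_m) : 'cV[R]_m :=
  mxpos A *m uL + mxneg A *m uR.

End MatrixAbs.

Lemma rv_sq_gt0 (R : realType) n (u : 'rV[R]_n) : u != 0 -> 0 < (u *m u^T) 0 0.
Proof.
move=> u0; rewrite mxE; under eq_bigr do rewrite mxE -expr2.
rewrite lt_neqAle sumr_ge0 ?andbT; last by move=> *; exact: sqr_ge0.
apply: contra u0 => /eqP /esym/psumr_eq0P h; apply/eqP/rowP => j; rewrite mxE.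
by apply/eqP; rewrite -sqrf_eq0; apply/eqP; apply: h => // *; exact: sqr_ge0.
Qed.

Lemma sym_eigen (R : realType) n (A : 'M[R]_n.+1) : A^T = A ->
  exists (v : 'rV_n.+1) (l : R), v *m v^T = 1%:M /\ v *m A = l *: v.
Proof.
move=> sA; pose C := R[i]%C; pose f : {rmorphism R -> C} := real_complex R.
pose AC : 'M[C]_n.+1 := map_mx f A.
have hA : AC \is hermsymmx.
  apply: realsym_hermsym.
    by apply/is_hermitianmxP; rewrite expr0 scale1r; apply/matrixP => i j; rewrite !mxE -[in LHS]sA mxE.
  by apply/mxOverP => i j; rewrite mxE; apply/complex_realP; exists (A i j).
have /orthomx_spectralP E := hermitian_normalmx hA.
have rD := hermitian_spectral_diag_real hA.
set P := spectralmx AC in E; set D := spectral_diag AC in E rD.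
have uP : P \in unitmx by exact: spectral_unit.
have [l El] : exists l, D 0 0 = f l.
  by apply/complex_realP; exact: (mxOverP rD).
have : eigenvalue A l.
  rewrite eigenvalue_root_char -(fmorph_root f) map_char_poly -eigenvalue_root_char.
  apply/eigenvalueP; exists (row 0 P).
    rewrite -row_mul -/AC {1}E !mulmxA mulmxV // mul1mx.
    by rewrite row_mul row_diag_mx -scalemxAl -rowE El.
  apply/negP => /eqP r0.
  have := congr1 (fun M => row 0 M) (mulmxV uP).
  rewrite row_mul r0 mul0mx row1 => /matrixP/(_ 0 0); rewrite !mxE eqxx /=.
  by move/esym/eqP; rewrite oner_eq0.
case/eigenvalueP => v vA v0.
pose s := (v *m v^T) 0 0.
have s0 : 0 < s by exact: rv_sq_gt0.
exists ((Num.sqrt s)^-1 *: v), l; split.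
  rewrite linearZ /= -scalemxAl -scalemxAr scalerA [v *m _]mx11_scalar -/s.
  rewrite scale_scalar_mx -expr2 exprVn sqr_sqrtr ?ltW // mulVf ?gt_eqF //.
by rewrite -scalemxAl vA scalerA mulrC -scalerA.
Qed.

Lemma householder (R : realType) n (v : 'rV[R]_n.+1) : v *m v^T = 1%:M ->
  exists H : 'M[R]_n.+1, [/\ H^T = H, H *m H = 1%:M & delta_mx 0 0 *m H = v].
Proof.
move=> vv; pose e : 'rV[R]_n.+1 := delta_mx 0 0.
have ee : e *m e^T = 1%:M.
  by rewrite /e trmx_delta mul_delta_mx; apply/matrixP=> i j; rewrite !mxE !ord1.
pose u := v - e; pose s := (u *m u^T) 0 0.
have [u0|u0] := eqVneq u 0.
  exists 1%:M; split; rewrite ?trmx1 ?mulmx1 //.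
  by move/eqP: u0; rewrite subr_eq0 => /eqP.
have us : u *m u^T = s%:M by rewrite [LHS]mx11_scalar.
have s0 : s != 0 by rewrite gt_eqF // rv_sq_gt0.
pose p := (e *m v^T) 0 0.
have ev : e *m v^T = p%:M by rewrite [LHS]mx11_scalar.
have eu : e *m u^T = (p - 1)%:M.
  by rewrite /u linearB /= mulmxBr ev ee raddfB.
have Es : s = 2 * (1 - p).
  rewrite /s /u linearB /= mulmxBr !mulmxBl vv ee.
  have -> : v *m e^T = (e *m v^T)^T by rewrite trmx_mul trmxK.
  rewrite ev tr_scalar_mx !mxE /=; ring.
exists (1%:M - (2 / s) *: (u^T *m u)); split.
- by rewrite linearB /= trmx1 linearZ /= trmx_mul trmxK.
- set X := u^T *m u; set q := 2 / s.
  have XX : X *m X = s *: X.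
    by rewrite /X mulmxA -[_ *m u *m _]mulmxA us mul_mx_scalar -scalemxAl.
  rewrite mulmxBr mulmx1 mulmxBl mul1mx -scalemxAl -scalemxAr XX !scalerA.
  have -> : q * q * s = q + q by rewrite /q; field.
  by rewrite scalerDl opprB addrK subrK.
rewrite mulmxBr mulmx1 -scalemxAr mulmxA eu mul_scalar_mx scalerA.
have -> : 2 / s * (p - 1) = - 1.
  by rewrite Es; field; rewrite ?subr_eq0; move: s0; rewrite Es mulf_eq0 pnatr_eq0 /= subr_eq0.
by rewrite scaleN1r opprK /u addrC subrK.
Qed.

Lemma mxabsP (R : realType) m (A : 'M[R]_m) : A^T = A ->
  is_mxabs A (mxabs A).
Proof.
move=> sA; rewrite /mxabs.
suff [Q [l [QQ AE]]] : exists (Q : 'M[R]_m) (l : 'rV[R]_m),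
   Q *m Q^T = 1%:M /\ A = Q^T *m diag_mx l *m Q.
  by case: xgetP => [B ->|/(_ (Q^T *m diag_mx (map_mx Num.norm l) *m Q)) []] //; exists Q, l.
elim: m A sA => [|n IH] A sA.
  by exists 1%:M, 0; split; apply/matrixP; case.
have [v [l [vv vA]]] := sym_eigen sA.
have [H [HT HH Hv]] := householder vv.
have [B BE] : exists B, B = H *m A *m H by exists (H *m A *m H).
have sB : B^T = B by rewrite BE !trmx_mul HT sA mulmxA.
have eB : delta_mx 0 0 *m B = l *: delta_mx 0 0 :> 'rV_n.+1.
  by rewrite BE !mulmxA Hv vA -scalemxAl -Hv -mulmxA HH mulmx1.
pose B' : 'M[R]_(1 + n) := B.
have B00 i : B 0 i = l * (i == 0)%:R.
  by have /rowP/(_ i) := eB; rewrite -rowE !mxE.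
have Bbl : B' = block_mx l%:M 0 0 (drsubmx B').
  rewrite -[LHS]submxK; congr block_mx; apply/matrixP => i j; rewrite !mxE.
  - by rewrite !ord1 !lshift0 B00 mulr_natr.
  - by rewrite !ord1 !lshift0 B00 /= mulr0.
  - by rewrite !ord1 lshift0 -[B' _ _]/(B _ _) -sB mxE B00 /= mulr0.
have [|Q' [l' [QQ E']]] := IH (drsubmx B').
  by rewrite trmx_drsub; congr drsubmx; exact: sB.
pose Q1 : 'M[R]_(1 + n) := block_mx 1%:M 0 0 Q'.
have Q1Q : Q1 *m Q1^T = 1%:M.
  by rewrite tr_block_mx mulmx_block !trmx0 !mul0mx !mulmx0 !addr0 add0r trmx1 mulmx1 QQ -scalar_mx_block.
pose d : 'rV_(1 + n) := row_mx l%:M l'.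
have E1 : B' = Q1^T *m diag_mx d *m Q1.
  rewrite Bbl tr_block_mx diag_mx_row !mulmx_block !trmx0 !(mul0mx, mulmx0, addr0, add0r, trmx1, mul1mx, mulmx1).
  by rewrite -E'; congr block_mx; apply/matrixP=> i j; rewrite !mxE !ord1 !mulr1n.
exists (Q1 *m H : 'M[R]_n.+1), d; split.
  by rewrite trmx_mul HT mulmxA -[_ *m H *m H]mulmxA HH mulmx1.
rewrite trmx_mul HT.
have -> : A = H *m B *m H by rewrite BE !mulmxA HH mul1mx -mulmxA HH mulmx1.
by rewrite -[B]/B' E1 !mulmxA.
Qed.
Lemma mxabs_unique (R : realType) m (A B : 'M[R]_m) :
  is_mxabs A B -> mxabs A = B.
Proof.
move=> hB; have : is_mxabs A (mxabs A).
  by rewrite /mxabs; case: xgetP => [? -> //|/(_ B)].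
case: hB => Q [l [QQ AE ->]] [P [k [PP AE' ->]]].
have QQ' := mulmx1C QQ; have PP' := mulmx1C PP.
pose M := P *m Q^T.
have comm (u v : 'rV[R]_m) : (P^T *m diag_mx u *m P = Q^T *m diag_mx v *m Q) <->
    (diag_mx u *m M = M *m diag_mx v).
  rewrite /M; split => [E|E].
    have /(congr1 (fun X => P *m X *m Q^T)) := E.
    by rewrite !mulmxA PP mul1mx -![_ *m Q *m Q^T]mulmxA QQ mulmx1.
  have /(congr1 (fun X => P^T *m X *m Q)) := E.
  by rewrite !mulmxA PP' mul1mx -![_ *m Q^T *m Q]mulmxA QQ' mulmx1.
have /comm : P^T *m diag_mx k *m P = Q^T *m diag_mx l *m Q by rewrite -AE -AE'.
rewrite mul_diag_mx mul_mx_diag => /matrixP E.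
apply/comm; rewrite mul_diag_mx mul_mx_diag; apply/matrixP => i j.
have := E i j; rewrite !mxE; set z := \sum_(_ | _) _.
have [-> _|z0] := eqVneq z 0; first by rewrite mulr0 mul0r.
move=> Ez; have {Ez}-> : k 0 i = l 0 j by apply: (mulIf z0); rewrite Ez mulrC.
exact: mulrC.
Qed.

Section LGL.
Context {R : realType}.

(* Rodrigues' formula *)
Definition legendre (N : nat) : {poly R} :=
  ((2 ^ N * N`!)%:R)^-1 *: (('X^2 - 1) ^+ N)^`(N).

(* ('X^2 - 1) * P_N' has degree N + 1, so N + 1 increasing roots are all of
   its roots, -1 and 1 included. *)
Definition LGL_nodes (N : nat) (xi : 'I_N.+1 -> R) : Prop :=
  (forall i j : 'I_N.+1, (i < j)%N -> xi i < xi j) /\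
  (forall j, root (('X^2 - 1) * (legendre N)^`()) (xi j)).

Definition LGL_weight (N : nat) (xi : 'I_N.+1 -> R) (j : 'I_N.+1) : R :=
  2 / ((N * N.+1)%:R * (legendre N).[xi j] ^+ 2).

Definition LGL_ip (N m : nat) (xi : 'I_N.+1 -> R) (f g : R -> 'cV[R]_m) : R :=
  \sum_(j < N.+1) ((f (xi j))^T *m g (xi j)) ord0 ord0 * LGL_weight xi j.

End LGL.

Section Mesh.
Context {R : realType}.

(* The mesh of [x0, x1] with n elements of equal size; element k is
   [x0 + k h, x0 + (k + 1) h] with h = mesh_size x0 x1 n. *)
Definition mesh_size (x0 x1 : R) (n : nat) : R := (x1 - x0) / n%:R.

Definition mesh_map (x0 x1 : R) (n : nat) (k : 'I_n) (xi : R) : R :=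
  x0 + mesh_size x0 x1 n * (k%:R + (xi + 1) / 2).

Definition mesh_coord (x0 x1 : R) (n : nat) (k : 'I_n) (x : R) : R :=
  2 * ((x - x0) / mesh_size x0 x1 n - k%:R) - 1.

Definition mesh_in (x0 x1 : R) (n : nat) (k : 'I_n) (x : R) : Prop :=
  mesh_map x0 x1 k (-1) <= x <= mesh_map x0 x1 k 1.

Definition mesh_norm2 (N m : nat) (xi : 'I_N.+1 -> R) (x0 x1 : R) (n : nat)
    (f : 'I_n -> R -> 'cV[R]_m) : R :=
  \sum_(k < n) mesh_size x0 x1 n / 2 * LGL_ip xi (f k) (f k).

End Mesh.

Section DGSEM.
Context {R : realType} {m : nat}.

Definition vpoly := 'cV[{poly R}]_m.

Definition veval (u : vpoly) (x : R) : 'cV[R]_m := \col_i (u i ord0).[x].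

Definition vderiv (u : vpoly) : vpoly := \col_i (u i ord0)^`().

Definition vdeg_le (N : nat) (u : vpoly) : Prop :=
  forall i, (size (u i ord0) <= N.+1)%N.

(* Time derivative, coefficient by coefficient, of a path of vectors of
   polynomials of degree at most N. *)
Definition vdt (N : nat) (u : R -> vpoly) (t : R) : vpoly :=
  \col_i \poly_(r < N.+1) derive1 (fun s => (u s i ord0)`_r) t.

(* States on the outer side of the left and right ends of element k; [gL] and
   [gR] are the external states at the two ends of the grid. [ord_pred] and
   [ordS] are cyclic, but are not used where they wrap around. *)
Definition left_state (n : nat) (gL : 'cV[R]_m) (u : 'I_n -> vpoly)
    (k : 'I_n) : 'cV[R]_m :=
  if k == 0%N :> nat then gL else veval (u (ord_pred k)) 1.

Definition right_state (n : nat) (gR : 'cV[R]_m) (u : 'I_n -> vpoly)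
    (k : 'I_n) : 'cV[R]_m :=
  if k.+1 == n then gR else veval (u (ordS k)) (-1).

(* The weak form on all elements of one grid, at one instant, with [ut] the
   time derivative. *)
Definition dgsem_eq (A : 'M[R]_m) (N : nat) (xi : 'I_N.+1 -> R) (x0 x1 : R)
    (n : nat) (gL gR : 'cV[R]_m) (u ut : 'I_n -> vpoly) : Prop :=
  forall (k : 'I_n) (phi : vpoly), vdeg_le N phi ->
    mesh_size x0 x1 n / 2 * LGL_ip xi (veval (ut k)) (veval phi)
    + (((veval phi 1)^T *m
          (upwind A (veval (u k) 1) (right_state gR u k)
           - flux A (veval (u k) 1))) ord0 ord0
       - ((veval phi (-1))^T *m
          (upwind A (left_state gL u k) (veval (u k) (-1))
           - flux A (veval (u k) (-1)))) ord0 ord0)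
    + LGL_ip xi (fun x => A *m veval (vderiv (u k)) x) (veval phi) = 0.

(* Elementwise polynomials of degree at most N whose coefficients are
   continuous on [0, T] and differentiable on ]0, T[. *)
Definition dgsem_path (N n : nat) (T : R) (u : R -> 'I_n -> vpoly) : Prop :=
  forall k : 'I_n,
    (forall t, t \in `[0, T] -> vdeg_le N (u t k)) /\
    (forall (i : 'I_m) (r : nat),
       {within `[0, T], continuous (fun t => (u t k i ord0)`_r)} /\
       (forall t, t \in `]0, T[ -> derivable (fun s => (u s k i ord0)`_r) t 1)).

Definition interpolates (N : nat) (xi : 'I_N.+1 -> R) (x0 x1 : R) (n : nat)
    (w0 : R -> 'cV[R]_m) (u : 'I_n -> vpoly) : Prop :=
  forall (k : 'I_n) (j : 'I_N.+1),
    veval (u k) (xi j) = w0 (mesh_map x0 x1 k (xi j)).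

(* The overset grid approximation up to time T: U on [a, c] with nu elements,
   V on [b, d] with nv elements, kb the base element in which U(b, t) is
   evaluated and kc the overset element in which V(c, t) is evaluated. *)
Definition overset_dgsem (A : 'M[R]_m) (N : nat) (xi : 'I_N.+1 -> R)
    (a b c d : R) (nu nv : nat) (kb : 'I_nu) (kc : 'I_nv) (T : R)
    (w0 : R -> 'cV[R]_m) (U : R -> 'I_nu -> vpoly) (V : R -> 'I_nv -> vpoly)
    : Prop :=
  [/\ dgsem_path N T U /\ dgsem_path N T V,
      interpolates xi a c w0 (U 0) /\ interpolates xi b d w0 (V 0),
      forall t, t \in `]0, T[ ->
        dgsem_eq A xi a c 0 (veval (V t kc) (mesh_coord b d kc c))
          (U t) (fun k => vdt N (fun s => U s k) t)
    & forall t, t \in `]0, T[ ->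
        dgsem_eq A xi b d (veval (U t kb) (mesh_coord a c kb b)) 0
          (V t) (fun k => vdt N (fun s => V s k) t)].

End DGSEM.

(* Main.v *)
Require Import Defs.
From HB Require Import structures.
From mathcomp Require Import all_boot all_order all_algebra.
From mathcomp Require Import all_classical all_reals all_analysis.
From mathcomp Require Import ring.
Set Implicit Arguments.
Unset Strict Implicit.
Unset Printing Implicit Defensive.
Import Order.TTheory GRing.Theory Num.Theory.
Import numFieldNormedType.Exports.
Local Open Scope classical_set_scope.
Local Open Scope ring_scope.

(** Testing the weak form with the solution itself gives E' = -2 B(U, V) for the
    energy E = |U|^2 + |V|^2, where B collects the flux and volume terms. As N
    and the mesh are fixed, the nodal values determine the solution and bound
    every trace and derivative in it, so |B| <= C E and Gronwall's inequality
    gives E(T) <= exp(2 C T) E(0). No dissipation or quadrature exactness is used,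
    only that E controls the nodal values, i.e. that the weights are positive.
    For this P_N must not vanish at the nodes, where the weight formula would
    give 2 / 0 = 0: the nodes are the simple roots of (x^2 - 1) P_N', whose
    derivative is N (N + 1) P_N by Legendre's equation. *)

(** * Legendre polynomials and positivity of the Lobatto weights *)

Lemma derivn_mulX (F : comNzRingType) (p : {poly F}) n :
  ('X * p)^`(n.+1) = 'X * p^`(n.+1) + p^`(n) *+ n.+1.
Proof.
elim: n => [|n IH]; first by rewrite derivSn derivn0 derivn1 derivM derivX mul1r addrC.
rewrite derivnS IH derivD derivM derivX mul1r derivMn -!derivnS.
by rewrite [_ + 'X * _]addrC -addrA -mulrS.
Qed.

Section Legendre.
Context {R : realType}.
Implicit Types (N : nat).

(** The factor x^2 - 1 is expanded into nested products by ['X], the shape on which [derivn_mulX]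
    computes derivatives of any order. *)
Lemma deriv_legendre_kernel N (u : {poly R}) : u = ('X^2 - 1) ^+ N ->
  'X * ('X * u^`()) - u^`() = 'X * u *+ (2 * N).
Proof.
have ring_id (F : comNzRingType) (x p : F) k :
    x * (x * ((x *+ 2) * p *+ k)) - (x *+ 2) * p *+ k = x * ((x ^+ 2 - 1) * p) *+ (2 * k).
  ring.
move=> ->; case: N => [|n].
  by rewrite expr0 derivC !mulr0 subrr muln0 mulr0n.
have -> : (('X^2 - 1 : {poly R}) ^+ n.+1)^`() = ('X *+ 2) * ('X^2 - 1) ^+ n *+ n.+1.
  by rewrite deriv_exp derivB derivXn derivC subr0 expr1.
by rewrite ring_id -exprS.
Qed.

(* The (N+1)-st derivative of (x^2 - 1) u' = 2 N x u for u = (x^2 - 1)^N. *)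
Lemma legendre_ode N :
  (('X^2 - 1) * (legendre (R:=R) N)^`())^`() = (N * N.+1)%:R *: legendre N.
Proof.
case: N => [|n].
  by rewrite /legendre expr0 derivn0 derivZ derivC scaler0 mulr0 deriv0 scale0r.
rewrite /legendre; set c := (_ %:R)^-1; move E : (('X^2 - 1) ^+ n.+1) => u.
move/esym/deriv_legendre_kernel/(congr1 (fun p => p^`(n.+2))): E.
rewrite derivnB derivnMn !derivn_mulX -!derivSn.
rewrite derivZ -scalerAr derivZ scalerA [_ * c]mulrC -scalerA => E.
congr (_ *: _); rewrite derivM derivB derivXn derivC subr0 expr1 -!derivnS -mul_polyC polyC_natr.
move: E; set w := u^`(n.+1); set w1 := u^`(n.+2); set w2 := u^`(n.+3).
(* Here N = k + 1. Once terms are collected, the differentiated identity and Legendre's equation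
   have the same difference of sides. *)
have ring_id (F : comNzRingType) (x v v1 v2 : F) k :
    x * (x * v2 + v1 *+ k.+2) + (x * v1 + v *+ k.+1) *+ k.+2 - v2
      = (x * v1 + v *+ k.+2) *+ (2 * k.+1) ->
    x *+ 2 * v1 + (x ^+ 2 - 1) * v2 = (k.+1 * k.+2)%:R * v.
  move=> E; apply/eqP; rewrite -subr_eq0; move/eqP: E; rewrite -subr_eq0 => /eqP E.
  by rewrite -[X in _ == X]E; apply/eqP; ring.
exact: ring_id.
Qed.

Lemma size_legendre N : (size (legendre (R:=R) N) <= N.+1)%N.
Proof.
apply: leq_trans (size_scale_leq _ _) _.
apply/leq_sizeP => j jN; rewrite coef_derivn nth_default ?mul0rn //.
apply: (@leq_trans (N * 2).+1); last first.
  by rewrite muln2 -addnn -addnS leq_add2l.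
by have := size_exp_leq ('X^2 - 1 : {poly R}) N; rewrite size_XnsubC //= mulnC.
Qed.

(** The coefficient of degree N - 1 is inspected: it is the leading coefficient of the monic (x^2 -
    1)^N, of degree 2 N, times a falling factorial and the normalizing constant, all nonzero. *)
Lemma legendre_deriv_neq0 N : (0 < N)%N -> (legendre (R:=R) N)^`() != 0.
Proof.
case: N => // n _; apply/eqP => /(congr1 (fun p : {poly R} => p`_n)).
rewrite /legendre derivZ -derivnS coefZ coef0 coef_derivn => /eqP.
have -> : (n.+2 + n = n.+1 * 2)%N by rewrite muln2 -addnn addSnnS.
have mq : ('X^2 - 1 : {poly R}) ^+ n.+1 \is monic by rewrite monic_exp // monicXnsubC.
have sq : size (('X^2 - 1 : {poly R}) ^+ n.+1) = (n.+1 * 2).+1.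
  have := size_exp ('X^2 - 1 : {poly R}) n.+1; rewrite size_XnsubC //= => E.
  rewrite mulnC -E prednK // lt0n size_poly_eq0; exact: monic_neq0.
have := monicP mq; rewrite lead_coefE sq /= => ->.
apply/negP; rewrite mulf_eq0 invr_eq0 !pnatr_eq0 muln_eq0 expn_eq0 /= !eqn0Ngt.
rewrite fact_gt0 ffact_gt0 muln2 -addnn addSn addnS /=.
by rewrite ltnS ltnS leq_addr.
Qed.

Lemma legendre_node_neq0 N (xi : 'I_N.+1 -> R) (j : 'I_N.+1) :
  (0 < N)%N -> injective xi ->
  (forall k, root (('X^2 - 1) * (legendre N)^`()) (xi k)) ->
  (legendre N).[xi j] != 0.
Proof.
move=> N0 xiI rt; set q := _ * _ in rt.
have q0 : q != 0.
  by rewrite mulf_neq0 ?legendre_deriv_neq0 // monic_neq0 // monicXnsubC.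
have sq : (size q <= N.+2)%N.
  apply: leq_trans (size_polyMleq _ _) _; rewrite size_XnsubC //= add2n ltnS.
  apply: leq_trans (size_legendre N).
  rewrite lt_size_deriv //; apply: contraTneq (legendre_deriv_neq0 N0) => ->.
  by rewrite deriv0 eqxx.
have /factor_theorem[g qE] := rt j.
have g0 : g != 0 by apply: contraNneq q0 => g0; rewrite qE g0 mul0r.
apply/negP => /eqP Pj.
(* At the node xi j, q' reduces to the cofactor g, so Legendre's equation turns a zero of P_N into a
   zero of g. *)
have gj : root g (xi j).
  have /(congr1 (fun p : {poly R} => p.[xi j])) := legendre_ode N.
  rewrite -/q hornerZ Pj mulr0 qE derivM derivXsubC mulr1 hornerD hornerM.
  rewrite hornerXsubC subrr mulr0 add0r.
  by move=> ?; apply/rootP.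
(* Now g vanishes at all N + 1 nodes, although its degree is at most N. *)
have : (size (codom xi) < size g)%N.
  apply: max_poly_roots => //; last by rewrite map_inj_uniq ?enum_uniq.
  apply/allP => _ /codomP[k ->]; have [->//|kj] := eqVneq k j.
  have := rt k; rewrite qE rootM root_XsubC => /orP[//|/eqP/xiI kj'].
  by rewrite kj' eqxx in kj.
rewrite size_codom card_ord ltnNge -ltnS.
have <- : size q = (size g).+1.
  by rewrite qE size_Mmonic ?monicXsubC // size_XsubC addn2.
by rewrite sq.
Qed.

Lemma LGL_weight_gt0 N (xi : 'I_N.+1 -> R) (j : 'I_N.+1) :
  (0 < N)%N -> injective xi ->
  (forall k, root (('X^2 - 1) * (legendre N)^`()) (xi k)) ->
  0 < LGL_weight xi j.
Proof.
move=> N0 xiI rt; rewrite /LGL_weight divr_gt0 // mulr_gt0 //.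
  by rewrite ltr0n muln_gt0 N0.
by rewrite exprn_even_gt0 // legendre_node_neq0.
Qed.

End Legendre.

Lemma LGL_nodes_inj (R : realType) N (xi : 'I_N.+1 -> R) :
  LGL_nodes xi -> injective xi.
Proof.
case=> lt_xi _ i j; case: (ltngtP i j) => [/lt_xi|/lt_xi|/val_inj //].
  by move=> /[swap] ->; rewrite ltxx.
by move=> /[swap] ->; rewrite ltxx.
Qed.

(** * Lagrange interpolation at distinct nodes *)

Lemma interpolation_basis (F : fieldType) n (x : 'I_n -> F) : injective x ->
  exists l : 'I_n -> {poly F},
    forall p : {poly F}, (size p <= n)%N -> p = \sum_(j < n) p.[x j] *: l j.
Proof.
move=> xI; pose q j := \prod_(i < n | i != j) ('X - (x i)%:P).
have qj j : (q j).[x j] != 0.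
  rewrite horner_prod; apply/prodf_neq0 => i ij.
  by rewrite hornerXsubC subr_eq0 (inj_eq xI) eq_sym.
have qi i j : i != j -> (q j).[x i] = 0.
  by move=> ij; rewrite horner_prod (bigD1 i) //= hornerXsubC subrr mul0r.
have sq j : (size (q j) <= n)%N.
  rewrite /q -big_filter size_prod_XsubC.
  have [e _ _ [_ ->]] := big_enumP.
  by rewrite cardC1 card_ord prednK // (leq_ltn_trans _ (ltn_ord j)).
exists (fun j => (q j).[x j]^-1 *: q j) => p sp; apply/eqP; rewrite -subr_eq0.
(* The interpolation error r has degree below n and vanishes at the n nodes, so it is zero. *)
set r := _ - _; have sr : (size r <= n)%N.
  rewrite (leq_trans (size_polyD _ _)) // geq_max sp size_polyN.
  apply: (leq_trans (size_sum _ _ _)); apply/bigmax_leqP => j _.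
  by rewrite !(leq_trans (size_scale_leq _ _)).
apply: contraTT sr => r0; rewrite -ltnNge -[n in X in (X < _)%N]card_ord -(size_codom x).
apply: max_poly_roots => //; last by rewrite map_inj_uniq ?enum_uniq.
apply/allP => _ /codomP[k ->]; apply/rootP; rewrite hornerD hornerN horner_sum.
rewrite (bigD1 k) //= big1 => [|j jk].
  by rewrite addr0 !hornerZ mulVf // mulr1 subrr.
by rewrite !hornerZ (qi k j) 1?eq_sym // !mulr0.
Qed.

(** * Uniform bounds by a control function *)

Section Dominated.
Context {R : realType} {S : Type}.
Variable P : S -> Prop.
Implicit Types f g : S -> R.

(** A big-O estimate over the states satisfying [P]. The constant is chosen before the state, which
    is what later makes K independent of the initial data; keeping it existential avoids explicit
    constants for traces and derivatives. *)
Definition dominated g f :=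
  exists2 C, 0 <= C & forall s, P s -> `|f s| <= C * g s.

Lemma dominated_ext g f f' :
  (forall s, P s -> f s = f' s) -> dominated g f -> dominated g f'.
Proof. by move=> e [C C0 h]; exists C => // s Ps; rewrite -e // h. Qed.

Lemma dominated0 g : dominated g (fun=> 0).
Proof. by exists 0 => // s _; rewrite normr0 mul0r. Qed.

Lemma dominatedN g f : dominated g f -> dominated g (fun s => - f s).
Proof. by case=> C C0 h; exists C => // s /h; rewrite normrN. Qed.

Lemma dominatedD g f f' :
  dominated g f -> dominated g f' -> dominated g (fun s => f s + f' s).
Proof.
move=> [C C0 h] [C' C'0 h']; exists (C + C'); first exact: addr_ge0.
by move=> s Ps; rewrite mulrDl (le_trans (ler_normD _ _)) // lerD ?h ?h'.
Qed.

Lemma dominatedB g f f' :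
  dominated g f -> dominated g f' -> dominated g (fun s => f s - f' s).
Proof. by move=> df df'; apply: dominatedD => //; exact: dominatedN. Qed.

Lemma dominatedZ g f c : dominated g f -> dominated g (fun s => c * f s).
Proof.
move=> [C C0 h]; exists (`|c| * C); first by rewrite mulr_ge0.
by move=> s Ps; rewrite normrM -mulrA ler_wpM2l // h.
Qed.

Lemma dominatedM g g' f f' : dominated g f -> dominated g' f' ->
  dominated (fun s => g s * g' s) (fun s => f s * f' s).
Proof.
move=> [C C0 h] [C' C'0 h']; exists (C * C'); first exact: mulr_ge0.
by move=> s Ps; rewrite normrM mulrACA ler_pM ?h ?h'.
Qed.

Lemma dominated_sum g (I : Type) (r : seq I) (f : I -> S -> R) :
  (forall i, dominated g (f i)) -> dominated g (fun s => \sum_(i <- r) f i s).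
Proof.
move=> h; elim: r => [|i r IH].
  by apply: dominated_ext (dominated0 g) => s _; rewrite big_nil.
by apply: dominated_ext (dominatedD (h i) IH) => s _; rewrite big_cons.
Qed.

Definition mx_dominated m g (v : S -> 'cV[R]_m) :=
  forall i, dominated g (fun s => v s i ord0).

Lemma mx_dominated0 m g : mx_dominated g (fun=> 0 : 'cV[R]_m).
Proof. by move=> i; apply: dominated_ext (dominated0 g) => s _; rewrite mxE. Qed.

Lemma mx_dominatedD m g (v w : S -> 'cV[R]_m) :
  mx_dominated g v -> mx_dominated g w -> mx_dominated g (fun s => v s + w s).
Proof.
move=> hv hw i; apply: dominated_ext (dominatedD (hv i) (hw i)) => s _.
by rewrite mxE.
Qed.

Lemma mx_dominatedB m g (v w : S -> 'cV[R]_m) :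
  mx_dominated g v -> mx_dominated g w -> mx_dominated g (fun s => v s - w s).
Proof.
move=> hv hw i; apply: dominated_ext (dominatedB (hv i) (hw i)) => s _.
by rewrite !mxE.
Qed.

Lemma mx_dominatedM m n g (M : 'M[R]_(m, n)) (v : S -> 'cV[R]_n) :
  mx_dominated g v -> mx_dominated g (fun s => M *m v s).
Proof.
move=> hv i; apply: (@dominated_ext _ (fun s => \sum_j M i j * v s j ord0)).
  by move=> s _; rewrite mxE.
by apply: dominated_sum => j; exact: dominatedZ.
Qed.

Lemma dominated_dot m g g' (v w : S -> 'cV[R]_m) :
  mx_dominated g v -> mx_dominated g' w ->
  dominated (fun s => g s * g' s) (fun s => ((v s)^T *m w s) ord0 ord0).
Proof.
move=> hv hw.
apply: (@dominated_ext _ (fun s => \sum_j v s j ord0 * w s j ord0)).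
  by move=> s _; rewrite mxE; apply: eq_bigr => j _; rewrite mxE.
by apply: dominated_sum => j; exact: dominatedM.
Qed.

Section Polynomials.
Context {m N : nat} (xi : 'I_N.+1 -> R) (xiI : injective xi) (g : S -> R).
Variable u : S -> vpoly (R:=R) (m:=m).
Hypothesis degu : forall s, P s -> vdeg_le N (u s).
Hypothesis nodeu : forall j, mx_dominated g (fun s => veval (u s) (xi j)).

(** On polynomials of degree at most N, a linear functional is a combination of nodal evaluations
    with coefficients [F (l j)] that do not depend on the state. Point values and derivatives are
    both instances. *)
Lemma dominated_poly_map (F : {linear {poly R} -> R | *%R}) i :
  dominated g (fun s => F (u s i ord0)).
Proof.
have [l lE] := interpolation_basis xiI.
apply: (@dominated_ext _
  (fun s => \sum_j F (l j) * veval (u s) (xi j) i ord0)).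
  move=> s Ps; rewrite [in RHS](lE _ (degu Ps i)) linear_sum.
  by apply: eq_bigr => j _; rewrite linearZ mxE mulrC.
by apply: dominated_sum => j; apply: dominatedZ; exact: nodeu.
Qed.

Lemma mx_dominated_veval x : mx_dominated g (fun s => veval (u s) x).
Proof.
move=> i; apply: dominated_ext (dominated_poly_map (horner_eval x) i) => s _.
by rewrite mxE.
Qed.

Lemma mx_dominated_veval_deriv x :
  mx_dominated g (fun s => veval (vderiv (u s)) x).
Proof.
move=> i; apply: dominated_ext
  (dominated_poly_map (horner_eval x \o @deriv R) i) => s _.
by rewrite !mxE.
Qed.

End Polynomials.
End Dominated.

(** * The spatial terms of the weak form *)

Section Residual.
Context {R : realType} {m N : nat}.
Variables (A : 'M[R]_m) (xi : 'I_N.+1 -> R).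

(* The spatial part of the weak form on element k, tested with phi = u k. *)
Definition dg_residual n (gL gR : 'cV[R]_m) (u : 'I_n -> vpoly) (k : 'I_n) : R :=
  ((veval (u k) 1)^T *m
     (upwind A (veval (u k) 1) (right_state gR u k)
      - flux A (veval (u k) 1))) ord0 ord0
  - ((veval (u k) (-1))^T *m
     (upwind A (left_state gL u k) (veval (u k) (-1))
      - flux A (veval (u k) (-1)))) ord0 ord0
  + LGL_ip xi (fun x => A *m veval (vderiv (u k)) x) (veval (u k)).

(** Each term pairs two quantities of size O(g): traces, external states, derivatives at nodes, or
    their images under fixed matrices. The nodal bound is assumed on every element because the
    interface fluxes use neighbouring traces. *)
Lemma dominated_residual S (P : S -> Prop) (g : S -> R) n
    (gL gR : S -> 'cV[R]_m) (u : S -> 'I_n -> vpoly) (k : 'I_n) :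
  injective xi -> (forall s k, P s -> vdeg_le N (u s k)) ->
  (forall k j, mx_dominated P g (fun s => veval (u s k) (xi j))) ->
  mx_dominated P g gL -> mx_dominated P g gR ->
  dominated P (fun s => g s * g s) (fun s => dg_residual (gL s) (gR s) (u s) k).
Proof.
move=> xiI degu nodeu hL hR.
have hev k' x : mx_dominated P g (fun s => veval (u s k') x).
  by apply: (mx_dominated_veval xiI (u := fun s => u s k')) => // s; exact: degu.
have hde k' x : mx_dominated P g (fun s => veval (vderiv (u s k')) x).
  by apply: (mx_dominated_veval_deriv xiI (u := fun s => u s k')) => // s; exact: degu.
have hup (v w : S -> 'cV[R]_m) : mx_dominated P g v -> mx_dominated P g w ->
    mx_dominated P g (fun s => upwind A (v s) (w s)).
  by move=> hv hw; apply: mx_dominatedD; exact: mx_dominatedM.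
have hfl (v : S -> 'cV[R]_m) : mx_dominated P g v ->
    mx_dominated P g (fun s => flux A (v s)).
  by move=> hv; exact: mx_dominatedM.
apply: dominatedD; [apply: dominatedB|]; rewrite /right_state /left_state.
- apply: dominated_dot => //; apply: mx_dominatedB; last exact: hfl.
  by apply: hup => //; case: (k.+1 == n).
- apply: dominated_dot => //; apply: mx_dominatedB; last exact: hfl.
  by apply: hup => //; case: (k == 0%N :> nat).
rewrite /LGL_ip; apply: dominated_sum => j.
apply: (@dominated_ext _ _ _ _ (fun s => LGL_weight xi j *
  ((A *m veval (vderiv (u s k)) (xi j))^T *m veval (u s k) (xi j)) ord0 ord0)).
  by move=> s _; rewrite mulrC.
by apply: dominatedZ; apply: dominated_dot => //; exact: mx_dominatedM.
Qed.

(** This is the choice phi = u on each element. When [ut] is the time derivative of [u], the left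
    side is half the rate of change of the discrete energy. *)
Lemma dgsem_eq_residual x0 x1 n gL gR (u ut : 'I_n -> vpoly) :
  (forall k, vdeg_le N (u k)) -> dgsem_eq A xi x0 x1 gL gR u ut ->
  \sum_(k < n) mesh_size x0 x1 n / 2 * LGL_ip xi (veval (ut k)) (veval (u k))
  = - \sum_(k < n) dg_residual gL gR u k.
Proof.
move=> du h; rewrite -sumrN; apply: eq_bigr => k _.
have := h k (u k) (du k); rewrite -addrA => /eqP.
by rewrite addr_eq0 => /eqP.
Qed.

End Residual.

(** * Control of nodal values by the discrete norm *)

Section NodalValues.
Context {R : realType} {m N : nat}.
Variables (xi : 'I_N.+1 -> R) (wt : forall j, 0 < LGL_weight xi j).

Lemma mesh_norm2E x0 x1 n (f : 'I_n -> R -> 'cV[R]_m) :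
  mesh_norm2 xi x0 x1 f = \sum_(k < n) \sum_(j < N.+1) \sum_(i < m)
    mesh_size x0 x1 n / 2 * LGL_weight xi j * f k (xi j) i ord0 ^+ 2.
Proof.
apply: eq_bigr => k _; rewrite mulr_sumr; apply: eq_bigr => j _.
rewrite mxE mulr_suml mulr_sumr; apply: eq_bigr => i _; rewrite mxE; ring.
Qed.

Lemma mesh_size_gt0 (x0 x1 : R) n : x0 < x1 -> (0 < n)%N ->
  0 < mesh_size x0 x1 n.
Proof. by move=> x01 n0; rewrite divr_gt0 ?subr_gt0 ?ltr0n. Qed.

Lemma mesh_weight_gt0 (x0 x1 : R) n j : x0 < x1 -> (0 < n)%N ->
  0 < mesh_size x0 x1 n / 2 * LGL_weight xi j.
Proof. by move=> x01 n0; rewrite mulr_gt0 // divr_gt0 // mesh_size_gt0. Qed.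

Lemma mesh_norm2_ge0 x0 x1 n (f : 'I_n -> R -> 'cV[R]_m) :
  x0 < x1 -> (0 < n)%N -> 0 <= mesh_norm2 xi x0 x1 f.
Proof.
move=> x01 n0; rewrite mesh_norm2E; do 3! (apply: sumr_ge0 => ? _).
by rewrite mulr_ge0 ?sqr_ge0 // ltW // mesh_weight_gt0.
Qed.

Lemma nodal_le_mesh_norm2 x0 x1 n (f : 'I_n -> R -> 'cV[R]_m) k j i :
  x0 < x1 -> (0 < n)%N ->
  mesh_size x0 x1 n / 2 * LGL_weight xi j * f k (xi j) i ord0 ^+ 2
  <= mesh_norm2 xi x0 x1 f.
Proof.
move=> x01 n0; have c0 j' : 0 <= mesh_size x0 x1 n / 2 * LGL_weight xi j'.
  by rewrite ltW // mesh_weight_gt0.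
rewrite mesh_norm2E (bigD1 k) //= (bigD1 j) //= (bigD1 i) //= -!addrA lerDl.
have t0 k' j' i' : 0 <= mesh_size x0 x1 n / 2 * LGL_weight xi j'
    * f k' (xi j') i' ord0 ^+ 2 by rewrite mulr_ge0 ?sqr_ge0.
by rewrite !addr_ge0 // !sumr_ge0 // => *; rewrite ?sumr_ge0 // => *; rewrite sumr_ge0.
Qed.

(** Positive weights make the norm a sum of nonnegative terms c y^2, so |y| is at most sqrt(1/c)
    sqrt(E). Taking sqrt(E) as control function makes products of two dominated quantities O(E). *)
Lemma mx_dominated_node S (P : S -> Prop) (E : S -> R) x0 x1 n
    (f : S -> 'I_n -> R -> 'cV[R]_m) k j :
  x0 < x1 -> (0 < n)%N -> (forall s, mesh_norm2 xi x0 x1 (f s) <= E s) ->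
  mx_dominated P (fun s => Num.sqrt (E s)) (fun s => f s k (xi j)).
Proof.
move=> x01 n0 hE i; set c := mesh_size x0 x1 n / 2 * LGL_weight xi j.
have c0 : 0 < c by exact: mesh_weight_gt0.
exists (Num.sqrt c^-1); first exact: sqrtr_ge0.
move=> s _; rewrite -sqrtrM ?invr_ge0 ?(ltW c0) // -sqrtr_sqr; apply: ler_wsqrtr.
rewrite ler_pdivlMl //; apply: le_trans (hE s).
exact: nodal_le_mesh_norm2.
Qed.

End NodalValues.

(** * Gronwall's inequality *)

Lemma ler_expR_derive (R : realType) (f df : R -> R) (C T : R) : 0 <= T ->
  {within `[0, T], continuous f} ->
  (forall t, t \in `]0, T[ -> is_derive t 1 f (df t)) ->
  (forall t, t \in `]0, T[ -> df t <= C * f t) ->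
  f T <= expR (C * T) * f 0.
Proof.
(* With the integrating factor exp(-C t), g has nonpositive derivative inside the interval;
   continuity extends the monotonicity to the end points. *)
move=> T0 fc fd fle; pose g t := f t * expR (- C * t).
have gd t : t \in `]0, T[ ->
    is_derive t 1 g ((df t - C * f t) * expR (- C * t)).
  move=> /fd ft; have dl : is_derive t 1 (fun s : R => - C * s) (- C).
    by apply: is_derive_eq; rewrite /GRing.scale /= !mulr1.
  have de := is_derive1_comp (is_derive_expR (- C * t)) dl.
  by apply: is_derive_eq; rewrite /GRing.scale /=; ring.
have gc : {within `[0, T], continuous g}.
  move=> t; apply: cvgM; first exact: fc.
  apply: (continuous_subspaceT (f := fun t : R => expR (- C * t))) => s.
  apply: continuous_comp; last exact: continuous_expR.
  by apply: cvgM; [exact: cvg_cst | exact: cvg_id].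
have : g T <= g 0.
  apply: (ler0_derive1_le_cc _ _ gc); rewrite ?in_itv /= ?lexx ?T0 //.
    by move=> t /gd.
  move=> t tT; have := gd t tT => dg; rewrite derive1E derive_val.
  by rewrite mulr_le0_ge0 ?expR_ge0 // subr_le0 fle.
rewrite /g mulr0 expR0 mulr1 mulNr expRN.
by rewrite ler_pdivrMr ?expR_gt0 // mulrC.
Qed.

(** * Time regularity of the discrete energy *)

Lemma within_continuous_sum (R : realType) (D : set R) (I : finType)
    (f : I -> R -> R) :
  (forall i, {within D, continuous (f i)}) ->
  {within D, continuous (fun t => \sum_i f i t)}.
Proof.
move=> fc; apply: continuous_big => [z|i _]; first exact: add_continuous.
exact: fc.
Qed.

Section Paths.
Context {R : realType} {m N : nat} (T : R).

Section OneElement.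
Variable u : R -> vpoly (R:=R) (m:=m).
Hypothesis degu : forall t, t \in `[0, T] -> vdeg_le N (u t).
Hypothesis cu : forall (i : 'I_m) (r : nat),
  {within `[0, T], continuous (fun t => (u t i ord0)`_r)}.
Hypothesis du : forall (i : 'I_m) (r : nat) t, t \in `]0, T[ ->
  derivable (fun s => (u s i ord0)`_r) t 1.

(** The degree bound gives a summation range that does not vary with time, so regularity of the
    coefficients passes to point values. *)
Lemma veval_path_sum t i x : t \in `[0, T] ->
  veval (u t) x i ord0 = \sum_(r < N.+1) (u t i ord0)`_r * x ^+ r.
Proof. by move=> tT; rewrite mxE (horner_coef_wide _ (degu tT i)). Qed.

Lemma veval_path_continuous i x :
  {within `[0, T], continuous (fun t => veval (u t) x i ord0)}.
Proof.
apply: (@subspace_eq_continuous _ _ _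
    (fun t => \sum_(r < N.+1) (u t i ord0)`_r * x ^+ r)).
  by move=> t /set_mem tT; rewrite /= -veval_path_sum.
apply: within_continuous_sum => r t.
by apply: cvgM; [exact: cu | exact: cvg_cst].
Qed.

Lemma veval_path_is_derive i x t : t \in `]0, T[ ->
  is_derive t 1 (fun s => veval (u s) x i ord0)
    (veval (vdt N u t) x i ord0).
Proof.
move=> tT.
(* The coefficient sum is valid only on [[0, T]], which is a neighbourhood of the interior time
   t. *)
apply: (@near_eq_is_derive _ _ _
    (fun s => \sum_(r < N.+1) (u s i ord0)`_r * x ^+ r)).
  apply: filterS (near_in_itvoo tT) => s sT; rewrite -veval_path_sum //.
  exact: subset_itv_oo_cc.
have -> : (fun s => \sum_(r < N.+1) (u s i ord0)`_r * x ^+ r)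
    = \sum_(r < N.+1) (fun s => (u s i ord0)`_r * x ^+ r).
  by apply/funext => s; rewrite fct_sumE.
have -> : veval (vdt N u t) x i ord0 =
    \sum_(r < N.+1) derive1 (fun s => (u s i ord0)`_r) t * x ^+ r.
  by rewrite !mxE horner_poly.
apply: is_derive_sum => r; have dr : is_derive t 1 (fun s => (u s i ord0)`_r)
    (derive1 (fun s => (u s i ord0)`_r) t).
  by rewrite derive1E; apply: derivableP; exact: du.
by apply: is_derive_eq; rewrite /GRing.scale /=; ring.
Qed.

End OneElement.

Variables (xi : 'I_N.+1 -> R) (x0 x1 : R) (n : nat).
Variables (u : R -> 'I_n -> vpoly (R:=R) (m:=m)) (pu : dgsem_path N T u).

Lemma mesh_norm2_continuous :
  {within `[0, T], continuous
    (fun t => mesh_norm2 xi x0 x1 (fun k => veval (u t k)))}.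
Proof.
apply: (@subspace_eq_continuous _ _ _ (fun t =>
    \sum_(k < n) \sum_(j < N.+1) \sum_(i < m)
      mesh_size x0 x1 n / 2 * LGL_weight xi j * veval (u t k) (xi j) i ord0 ^+ 2)).
  by move=> t _; apply/esym; exact: mesh_norm2E.
apply: within_continuous_sum => k; apply: within_continuous_sum => j.
apply: within_continuous_sum => i.
move=> t; apply: cvgM; first exact: cvg_cst.
have [dk ck] := pu k.
by apply: cvgM; apply: (veval_path_continuous dk) => // i' r; have [] := ck i' r.
Qed.

(** The factor 2 comes from differentiating squares; what remains is the time term of the weak form
    tested with the solution, as [dgsem_eq_residual] expects it. *)
Lemma mesh_norm2_is_derive t : t \in `]0, T[ ->
  is_derive t 1 (fun s => mesh_norm2 xi x0 x1 (fun k => veval (u s k)))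
    (2 * \sum_(k < n) mesh_size x0 x1 n / 2 *
      LGL_ip xi (veval (vdt N (fun s => u s k) t)) (veval (u t k))).
Proof.
move=> tT; pose c j := mesh_size x0 x1 n / 2 * LGL_weight xi j.
pose y k j i s := veval (u s k) (xi j) i ord0.
pose dy k j i := veval (vdt N (fun s => u s k) t) (xi j) i ord0.
have -> : (fun s => mesh_norm2 xi x0 x1 (fun k => veval (u s k)))
    = \sum_(k < n) \sum_(j < N.+1) \sum_(i < m) (fun s => c j * y k j i s ^+ 2).
  apply/funext => s; rewrite mesh_norm2E fct_sumE; apply: eq_bigr => k _.
  by rewrite fct_sumE; apply: eq_bigr => j _; rewrite fct_sumE.
have -> : 2 * \sum_(k < n) mesh_size x0 x1 n / 2 *
      LGL_ip xi (veval (vdt N (fun s => u s k) t)) (veval (u t k))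
    = \sum_(k < n) \sum_(j < N.+1) \sum_(i < m) c j * (2 * y k j i t * dy k j i).
  rewrite mulr_sumr; apply: eq_bigr => k _; rewrite !mulr_sumr.
  apply: eq_bigr => j _; rewrite mxE mulr_suml !mulr_sumr.
  by apply: eq_bigr => i _; rewrite mxE /c /y /dy; ring.
apply: is_derive_sum => k; apply: is_derive_sum => j; apply: is_derive_sum => i.
have [du cu] := pu k.
have dyt : is_derive t 1 (y k j i) (dy k j i).
  by apply: veval_path_is_derive => // i' r; have [] := cu i' r.
by apply: is_derive_eq; rewrite /GRing.scale /= /y; ring.
Qed.

End Paths.

(** * The energy estimate on the overset grid *)

Section Energy.
Context {R : realType} {m N : nat}.
Variables (A : 'M[R]_m) (xi : 'I_N.+1 -> R) (hN : (0 < N)%N).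
Variable hxi : LGL_nodes xi.
Variables (a b c d : R) (hac : a < c) (hbd : b < d).
Variables (nu nv : nat) (hnu : (0 < nu)%N) (hnv : (0 < nv)%N).

Let xiI := LGL_nodes_inj hxi.
Let wt j : 0 < LGL_weight xi j := LGL_weight_gt0 j hN xiI hxi.2.

Local Notation energy U V :=
  (mesh_norm2 xi a c (fun k => veval (U k))
   + mesh_norm2 xi b d (fun k => veval (V k))).

Lemma overset_residual_bound (kb : 'I_nu) (kc : 'I_nv) (xb xc : R) :
  exists2 C, 0 <= C &
    forall (U : 'I_nu -> vpoly (R:=R) (m:=m)) (V : 'I_nv -> vpoly),
      (forall k, vdeg_le N (U k)) -> (forall k, vdeg_le N (V k)) ->
      `|\sum_k dg_residual A xi 0 (veval (V kc) xc) U k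
        + \sum_k dg_residual A xi (veval (U kb) xb) 0 V k|
      <= C * energy U V.
Proof.
(* Each grid receives a point value of the other solution. Both solutions are therefore packed into
   one state, controlled by the square root of the joint energy. *)
pose S := (('I_nu -> vpoly (R:=R) (m:=m)) * ('I_nv -> vpoly (R:=R) (m:=m)))%type.
pose P (s : S) := (forall k, vdeg_le N (s.1 k)) /\ (forall k, vdeg_le N (s.2 k)).
pose E (s : S) := energy s.1 s.2.
pose g (s : S) := Num.sqrt (E s).
have nU0 (s : S) : 0 <= mesh_norm2 xi a c (fun k => veval (s.1 k)).
  exact: mesh_norm2_ge0.
have nV0 (s : S) : 0 <= mesh_norm2 xi b d (fun k => veval (s.2 k)).
  exact: mesh_norm2_ge0.
have nodeU k j : mx_dominated P g (fun s => veval (s.1 k) (xi j)).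
  apply: (@mx_dominated_node _ _ _ xi wt S P E a c nu (fun s k => veval (s.1 k))) => // s.
  by rewrite lerDl.
have nodeV k j : mx_dominated P g (fun s => veval (s.2 k) (xi j)).
  apply: (@mx_dominated_node _ _ _ xi wt S P E b d nv (fun s k => veval (s.2 k))) => // s.
  by rewrite lerDr.
have extU x : mx_dominated P g (fun s => veval (s.1 kb) x).
  by apply: (mx_dominated_veval xiI (u := fun s : S => s.1 kb)) => // s [].
have extV x : mx_dominated P g (fun s => veval (s.2 kc) x).
  by apply: (mx_dominated_veval xiI (u := fun s : S => s.2 kc)) => // s [].
have [C C0 hC] : dominated P (fun s => g s * g s) (fun s =>
    \sum_k dg_residual A xi 0 (veval (s.2 kc) xc) s.1 k
    + \sum_k dg_residual A xi (veval (s.1 kb) xb) 0 s.2 k).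
  apply: dominatedD; apply: dominated_sum => k.
    apply: (dominated_residual A (u := fun s : S => s.1)) => //.
    - by move=> s k' [].
    - exact: mx_dominated0.
  apply: (dominated_residual A (u := fun s : S => s.2)) => //.
  - by move=> s k' [].
  - exact: mx_dominated0.
exists C => // U V dU dV; have := hC (U, V) (conj dU dV).
by rewrite /g -expr2 sqr_sqrtr // addr_ge0.
Qed.

Lemma overset_energy_growth (kb : 'I_nu) (kc : 'I_nv) (T : R) : 0 <= T ->
  exists2 K, 0 <= K &
    forall w0 (U : R -> 'I_nu -> vpoly (R:=R) (m:=m)) (V : R -> 'I_nv -> vpoly),
      overset_dgsem A xi a b c d kb kc T w0 U V ->
      energy (U T) (V T) <= K * energy (U 0) (V 0).
Proof.
move=> T0.
have [C C0 hC] := overset_residual_bound kb kc (mesh_coord a c kb b) (mesh_coord b d kc c).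
(* The rate is 2 C because E' is -2 times the summed residuals, which are at most C E in absolute
   value. *)
exists (expR (2 * C * T)) => [|w0 U V [[pU pV] _ eqU eqV]]; first exact: expR_ge0.
pose dE t := 2 * \sum_(k < nu) mesh_size a c nu / 2 *
    LGL_ip xi (veval (vdt N (fun s => U s k) t)) (veval (U t k))
  + 2 * \sum_(k < nv) mesh_size b d nv / 2 *
    LGL_ip xi (veval (vdt N (fun s => V s k) t)) (veval (V t k)).
apply: (@ler_expR_derive _ (fun t => energy (U t) (V t)) dE) => //.
- by apply: within_continuousD; exact: mesh_norm2_continuous.
- by move=> t tT; apply: is_deriveD; exact: mesh_norm2_is_derive.
move=> t tT; have tT' : t \in `[0, T] by exact: subset_itv_oo_cc.
have dU k : vdeg_le N (U t k) by have [+ _] := pU k; exact.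
have dV k : vdeg_le N (V t k) by have [+ _] := pV k; exact.
rewrite /dE (dgsem_eq_residual dU (eqU t tT)) (dgsem_eq_residual dV (eqV t tT)).
rewrite -mulrDr -mulrA ler_pM2l // -opprD.
by apply: le_trans (hC _ _ dU dV); rewrite -normrN ler_norm.
Qed.

(** The discrete norm sees a function only through its nodal values, where the interpolant agrees
    with the initial datum. *)
Lemma interpolates_mesh_norm2 x0 x1 n (w0 : R -> 'cV[R]_m) (u : 'I_n -> vpoly) :
  interpolates xi x0 x1 w0 u ->
  mesh_norm2 xi x0 x1 (fun k => veval (u k))
  = mesh_norm2 xi x0 x1 (fun (k : 'I_n) x => w0 (mesh_map x0 x1 k x)).
Proof.
move=> h; apply: eq_bigr => k _; congr (_ * _); apply: eq_bigr => j _.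
by rewrite h.
Qed.

End Energy.

Theorem theorem2 (R : realType) (m : nat) (A : 'M[R]_m) (hA : A^T = A)
    (a b c d : R) (hab : a < b) (hbc : b < c) (hcd : c < d)
    (N : nat) (hN : (1 <= N)%N) (xi : 'I_N.+1 -> R) (hxi : LGL_nodes xi)
    (nu nv : nat) (hnu : (0 < nu)%N) (hnv : (0 < nv)%N)
    (T : R) (hT : 0 <= T) :
  exists K : R,
    forall (kb : 'I_nu) (kc : 'I_nv),
      mesh_in a c kb b -> mesh_in b d kc c ->
    forall (w0 : R -> 'cV[R]_m)
      (U : R -> 'I_nu -> 'cV[{poly R}]_m) (V : R -> 'I_nv -> 'cV[{poly R}]_m),
      overset_dgsem A xi a b c d kb kc T w0 U V ->
      mesh_norm2 xi a c (fun k => veval (U T k))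
        + mesh_norm2 xi b d (fun k => veval (V T k))
      <= K * (mesh_norm2 xi a c (fun (k : 'I_nu) x => w0 (mesh_map a c k x))
              + mesh_norm2 xi b d (fun (k : 'I_nv) x => w0 (mesh_map b d k x))).
Proof.
have hac := lt_trans hab hbc; have hbd := lt_trans hbc hcd.
have wt j := LGL_weight_gt0 j hN (LGL_nodes_inj hxi) hxi.2.
have /choice[K hK] (kk : 'I_nu * 'I_nv) : exists K, 0 <= K /\
    forall w0 (U : R -> 'I_nu -> 'cV[{poly R}]_m) (V : R -> 'I_nv -> 'cV[{poly R}]_m),
      overset_dgsem A xi a b c d kk.1 kk.2 T w0 U V ->
      mesh_norm2 xi a c (fun k => veval (U T k))
        + mesh_norm2 xi b d (fun k => veval (V T k))
      <= K * (mesh_norm2 xi a c (fun k => veval (U 0 k))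
        + mesh_norm2 xi b d (fun k => veval (V 0 k))).
  have [K K0 h] := overset_energy_growth A hN hxi hac hbd hnu hnv kk.1 kk.2 hT.
  by exists K.
(* K must precede the choice of the elements containing b and c, which is ambiguous at an element
   interface. There are finitely many pairs, and the sum of their nonnegative constants bounds each
   of them. *)
exists (\sum_kk K kk) => kb kc _ _ w0 U V h.
have [_ [iU iV] _ _] := h.
rewrite -(interpolates_mesh_norm2 iU) -(interpolates_mesh_norm2 iV).
apply: le_trans ((hK (kb, kc)).2 w0 U V h) _; apply: ler_wpM2r.
  by rewrite addr_ge0 ?mesh_norm2_ge0.
by rewrite (bigD1 (kb, kc)) //= lerDl sumr_ge0 // => kk _; have [] := hK kk.
Qed.
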